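(* Let $u\ge2$, $n\ge2$, $N\ge1$, $d\ge2$, and let $D=(r_{kj})$ be an $n\times N$ difference scheme based on $Z_u$. Let $M=(m_{kj})$ be the complex $n\times N$ matrix with $m_{kj}=e^{2\pi i r_{kj}/u}$. Then $$MM^\dagger=N\,\mathbf{1}_n ,$$ and $M$ decouples every bilinear coupling of $n$ harmonic oscillators: with $W_j:=\prod_{k=1}^n\exp\!\big(ih_k\,2\pi r_{kj}/u\big)$ for $j=1,\dots,N$, one has $$\sum_{j=1}^NW_jH_CW_j^\dagger=0$$ for every $H_C=\sum_{k,l}c_{kl}\,a_ka_l^\dagger$ with $C=(c_{kl})$ a real symmetric $n\times n$-matrix with zeros on the diagonal.
   Context: $Z_u=\{0,1,\dots,u-1\}$ is the cyclic group of order $u$. An $n\times N$ array with entries in $Z_u$ is called a difference scheme based on $Z_u$ if the difference vector (modulo $u$) of any two distinct rows has the property that each element of $Z_u$ occurs equally often in it. Each of the $n$ oscillators has Hilbert space $\mathbb{C}^d$ with orthonormal basis $|0\rangle,\dots,|d-1\rangle$. The annihilation operator $a$ is defined by $a|0\rangle=0$, $a|E\rangle=\sqrt{E}\,|E-1\rangle$ for $E=1,\dots,d-1$; $a_k$ and $a_k^\dagger$ are the annihilation operator and its adjoint acting on the $k$-th tensor factor of $(\mathbb{C}^d)^{\otimes n}$, and $h_k$ is $\mathrm{diag}(0,1,\dots,d-1)$ acting on the $k$-th factor. $\mathbf{1}_n$ is the $n\times n$ identity matrix. *)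

(* Defs.v *)
From HB Require Import structures.
From mathcomp Require Import all_boot all_order all_algebra.
From mathcomp Require Import complex.
From mathcomp Require Import all_classical all_reals all_analysis.
Import Order.TTheory GRing.Theory Num.Theory.
Import numFieldNormedType.Exports.

Set Implicit Arguments.
Unset Strict Implicit.
Unset Printing Implicit Defensive.

Local Open Scope ring_scope.
Local Open Scope complex_scope.
Local Open Scope sesquilinear_scope.
Local Open Scope classical_set_scope.

(* Meant for 1 < u: 'Z_0 and 'Z_1 both denote the integers modulo 2. *)
Definition difference_scheme (u n N : nat) (D : 'M['Z_u]_(n, N)) : Prop :=
  forall k l : 'I_n, k != l -> forall x y : 'Z_u,
    #|[set j : 'I_N | D k j - D l j == x]%SET| =
    #|[set j : 'I_N | D k j - D l j == y]%SET|.

Definition cexp (R : realType) (z : R[i]) : R[i] :=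
  (expR (complex.Re z))%:C * (cos (complex.Im z) +i* sin (complex.Im z)).

(* The limit is taken in the sup norm of the entries; the series converges for
   every A. *)
Definition expmx (R : realType) (m : nat) (A : 'M[R[i]]_m) : 'M[R[i]]_m :=
  limn (fun p : nat => \sum_(0 <= q < p) (q`!%:R : R[i])^-1 *: A ^+ q).

(* The orthonormal basis |x 0> (x) ... (x) |x (n-1)> of (C^d)^{(x) n} is indexed
   by the functions x : {ffun 'I_n -> 'I_d}, through enum_val. *)
Definition tdim (n d : nat) : nat := #|{: {ffun 'I_n -> 'I_d}}|.

Definition tensor_op (R : rcfType) (n d : nat) (A : 'I_n -> 'M[R[i]]_d) :
  'M[R[i]]_(tdim n d) :=
  \matrix_(s, t) \prod_(k < n)
     A k ((enum_val s : {ffun 'I_n -> 'I_d}) k)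
         ((enum_val t : {ffun 'I_n -> 'I_d}) k).

Definition on_factor (R : rcfType) (n d : nat) (k : 'I_n) (A : 'M[R[i]]_d) :
  'M[R[i]]_(tdim n d) :=
  tensor_op (fun l => if l == k then A else 1%:M).

(* Operators act on column vectors: the entry (E', E) is <E'|a|E>. *)
Definition annihilation (R : rcfType) (d : nat) : 'M[R[i]]_d :=
  \matrix_(E', E) (if E'.+1 == E :> nat then (Num.sqrt E%:R)%:C else 0).

Definition number_op (R : rcfType) (d : nat) : 'M[R[i]]_d :=
  diag_mx (\row_E E%:R).

Definition ann_factor (R : rcfType) (n d : nat) (k : 'I_n) : 'M[R[i]]_(tdim n d) :=
  on_factor k (annihilation R d).

Definition number_factor (R : rcfType) (n d : nat) (k : 'I_n) : 'M[R[i]]_(tdim n d) :=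
  on_factor k (number_op R d).

Definition bilinear_coupling (R : rcfType) (n d : nat) (c : 'M[R]_n) :
  'M[R[i]]_(tdim n d) :=
  \sum_(k < n) \sum_(l < n)
    (c k l)%:C *: (ann_factor R d k *m (ann_factor R d l)^t*).

Definition phase_mx (R : realType) (u n N : nat) (D : 'M['Z_u]_(n, N)) :
  'M[R[i]]_(n, N) :=
  \matrix_(k, j) cexp ('i%C * (2 * pi * (D k j)%:R / u%:R)%:C).

Definition decoupler (R : realType) (u n N d : nat) (D : 'M['Z_u]_(n, N))
  (j : 'I_N) : 'M[R[i]]_(tdim n d) :=
  \prod_(k < n)
    expmx (('i%C * (2 * pi * (D k j)%:R / u%:R)%:C) *: number_factor R d k).

(* Main.v *)
Require Import Defs.
From mathcomp Require Import all_boot all_order all_algebra.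
From mathcomp Require Import complex.
From mathcomp Require Import ring.
From mathcomp Require Import all_classical all_reals all_analysis.
Import Order.TTheory GRing.Theory Num.Theory.
Import numFieldNormedType.Exports.

Set Implicit Arguments.
Unset Strict Implicit.
Unset Printing Implicit Defensive.

Local Open Scope ring_scope.
Local Open Scope complex_scope.
Local Open Scope sesquilinear_scope.

(** The number operators are diagonal, so W_j is the diagonal unitary with
    eigenvalue prod_k m_kj^(x_k) on the basis state |x>.  As a_k lowers x_k by
    one, W_j a_k W_j^dagger = conj(m_kj) a_k, so conjugation by W_j scales
    a_k a_l^dagger by m_lj conj(m_kj).  Summed over j this factor is the entry
    (l, k) of M M^dagger, which vanishes for k <> l because the sum
    runs over all u-th roots of unity, each taken equally often. *)

(** * Entrywise and coordinatewise convergence *)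

Lemma cvg_mx_entrywise (K : numFieldType) m n (f : nat -> 'M[K]_(m, n))
    (l : 'M[K]_(m, n)) :
  (forall i j, f p i j @[p --> \oo] --> l i j)%classic ->
  (f @ \oo --> l)%classic.
Proof.
move=> cvf; apply/cvg_ballP => e e0.
(* There are finitely many entries, so a single threshold on [p] serves them all. *)
have : (\forall p \near \oo, forall ij : 'I_m * 'I_n,
    ball (l ij.1 ij.2) e (f p ij.1 ij.2))%classic.
  by apply: filter_forall => -[i j]; move/cvg_ballP: (cvf i j); exact.
by apply: filterS => p fp; split=> // i j; exact: (fp (i, j)).
Qed.

Lemma cvg_complex_ReIm (R : realType) (f : nat -> R[i]) (l : R[i]) :
  (complex.Re (f p) @[p --> \oo] --> complex.Re l)%classic ->
  (complex.Im (f p) @[p --> \oo] --> complex.Im l)%classic ->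
  ((f : nat -> (R[i] : numFieldType)) @ \oo --> (l : (R[i] : numFieldType)))%classic.
Proof.
(* In the partial order of [R[i]], positivity of the radius forces its imaginary part to be 0, so it
   is a real [x > 0]; each coordinate then gets half of it. *)
move=> cRe cIm; apply/cvgrPdist_lt => -[x y]; rewrite ltcE /= => /andP[/eqP-> x0].
have x20 : 0 < x / 2 by rewrite divr_gt0.
move/cvgrPdist_lt/(_ _ x20): cRe => cRe.
move/cvgrPdist_lt/(_ _ x20): cIm => cIm.
near=> p.
rewrite (complexE (l - f p)); apply: le_lt_trans (ler_normD _ _) _.
have normR (a : R) : `|a%:C| = `|a|%:C by rewrite normc_def /= expr0n addr0 sqrtr_sqr.
have normI : `|'i%C : R[i]| = 1 by rewrite normc_def /= expr0n expr1n add0r sqrtr1.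
rewrite normrM normI mul1r !normR -rmorphD /= ltcR [ltRHS](splitr x) ltrD //.
- by rewrite raddfB; near: p.
- by rewrite raddfB; near: p.
Unshelve. all: by end_near. Qed.

(** * Powers and products of diagonal matrices *)

Lemma diag_mxX (K : comPzRingType) m (v : 'rV[K]_m) q :
  diag_mx v ^+ q = diag_mx (\row_s v 0 s ^+ q).
Proof.
elim: q => [|q IH].
  by apply/matrixP => i j; rewrite expr0 !mxE expr0.
by rewrite exprS IH -[_ * _]/(_ *m _) mulmx_diag; congr diag_mx;
  apply/rowP => i; rewrite !mxE exprS.
Qed.

Lemma prod_diag_mx (K : comPzRingType) m (I : Type) (r : seq I)
    (v : I -> 'rV[K]_m) :
  \prod_(k <- r) diag_mx (v k) = diag_mx (\row_s \prod_(k <- r) v k 0 s).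
Proof.
elim: r => [|k r IH].
  by rewrite big_nil; apply/matrixP => i j; rewrite !mxE big_nil.
by rewrite big_cons IH -[_ * _]/(_ *m _) mulmx_diag; congr diag_mx;
  apply/rowP => i; rewrite !mxE big_cons.
Qed.

(** * The exponential on the imaginary axis and its power series *)

Lemma cexp_imag (R : realType) (t : R) : cexp ('i%C * t%:C) = cos t +i* sin t.
Proof.
rewrite /cexp; have -> : 'i%C * t%:C = 0 +i* t.
  by apply/eqP; rewrite eq_complex /=; apply/andP; split; apply/eqP; ring.
by rewrite /= expR0 mul1r.
Qed.

Lemma cexp_imagD (R : realType) (s t : R) :
  cexp ('i%C * (s + t)%:C) = cexp ('i%C * s%:C) * cexp ('i%C * t%:C).
Proof.
rewrite !cexp_imag cosD sinD; apply/eqP.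
by rewrite eq_complex /= eqxx [X in _ == X]addrC eqxx.
Qed.

Lemma cexp_imagMn (R : realType) (t : R) q :
  cexp ('i%C * (t * q%:R)%:C) = cexp ('i%C * t%:C) ^+ q.
Proof.
elim: q => [|q IH].
  by rewrite mulr0 cexp_imag cos0 sin0 expr0.
by rewrite -addn1 natrD mulrDr mulr1 cexp_imagD IH addn1 exprSr.
Qed.

Lemma cexp_imag_unit (R : realType) (t : R) :
  cexp ('i%C * t%:C) * Num.conj (cexp ('i%C * t%:C)) = 1.
Proof.
rewrite cexp_imag; apply/eqP; rewrite eq_complex /=.
by rewrite mulrN opprK -!expr2 cos2Dsin2 mulrN mulrC addNr !eqxx.
Qed.

Lemma Re_sum (R : rcfType) (I : Type) (r : seq I) (F : I -> R[i]) :
  complex.Re (\sum_(q <- r) F q) = \sum_(q <- r) complex.Re (F q).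
Proof. by elim/big_rec2: _ => // q x y _ <-; case: (F q); case: y. Qed.

Lemma Im_sum (R : rcfType) (I : Type) (r : seq I) (F : I -> R[i]) :
  complex.Im (\sum_(q <- r) F q) = \sum_(q <- r) complex.Im (F q).
Proof. by elim/big_rec2: _ => // q x y _ <-; case: (F q); case: y. Qed.

(** Writing q = 2h + r with r the parity of q gives i^q = (-1)^h i^r: even terms are real, odd terms
    imaginary, matching the vanishing pattern of the cosine and sine coefficients. *)
Lemma exp_term_imag (R : realType) (t : R) q :
  (q`!%:R : R[i])^-1 * ('i%C * t%:C) ^+ q = cos_coeff t q +i* sin_coeff t q.
Proof.
have qR : (q`!%:R : R[i])^-1 = ((q`!%:R)^-1)%:C by rewrite [RHS](fmorphV (real_complex R)) rmorph_nat.
rewrite exprMn -rmorphXn /= mulrCA qR -rmorphM /= /cos_coeff /sin_coeff /=.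
have sgn k : (-1 : R[i]) ^+ k = ((-1) ^+ k)%:C by rewrite rmorphXn rmorphN rmorph1.
rewrite -exprnP -!mulrA [t ^+ q / _]mulrC; move: (_^-1 * _) => a.
rewrite -{1}(odd_double_half q) exprD -mul2n exprM sqr_i sgn.
case: (boolP (odd q)) => oq /=.

  (* [sin_coeff] carries the sign exponent [q.-1./2], which agrees with [q./2] because [q] is
     odd. *)
  have -> : q.-1./2 = q./2.
    by rewrite -{1}(odd_double_half q) oq add1n /= doubleK.
  by apply/eqP; rewrite eq_complex /=; apply/andP; split; apply/eqP; ring.
by apply/eqP; rewrite eq_complex /=; apply/andP; split; apply/eqP; ring.
Qed.

Lemma cvg_exp_imag (R : realType) (t : R) :
  (((fun p => \sum_(0 <= q < p) (q`!%:R : R[i])^-1 * ('i%C * t%:C) ^+ q)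
      : nat -> (R[i] : numFieldType)) @ \oo
    --> (cexp ('i%C * t%:C) : (R[i] : numFieldType)))%classic.
Proof.
rewrite cexp_imag; apply: cvg_complex_ReIm => /=.
  have -> : (fun p => complex.Re (\sum_(0 <= q < p) (q`!%:R : R[i])^-1 * ('i%C * t%:C) ^+ q))
     = series (cos_coeff t).
    by apply/funext => p; rewrite Re_sum; apply: eq_bigr => q _; rewrite exp_term_imag.
  (* [cos] unlocks to the limit of this very series, so its convergence is all that is required. *)
  by rewrite unlock; exact: is_cvg_series_cos_coeff.
have -> : (fun p => complex.Im (\sum_(0 <= q < p) (q`!%:R : R[i])^-1 * ('i%C * t%:C) ^+ q))
   = series (sin_coeff t).
  by apply/funext => p; rewrite Im_sum; apply: eq_bigr => q _; rewrite exp_term_imag.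
by rewrite unlock; exact: is_cvg_series_sin_coeff.
Qed.

Lemma expmx_diag_imag (R : realType) m (v : 'rV[R]_m) :
  expmx (diag_mx (\row_s ('i%C * (v 0 s)%:C)) : 'M[R[i]]_m)
    = diag_mx (\row_s cexp ('i%C * (v 0 s)%:C)).
Proof.
(* [expmx] is a [limn], so it is identified by exhibiting a limit and using uniqueness in a
   Hausdorff space. Off the diagonal the partial sums are constantly 0. *)
apply: (@cvg_lim ('M[R[i]]_m : normedModType R[i])); first exact: norm_hausdorff.
apply: cvg_mx_entrywise => i j; rewrite !mxE.
have -> : (fun p => (\sum_(0 <= q < p) (q`!%:R : R[i])^-1 *:
      diag_mx (\row_s ('i%C * (v 0 s)%:C)) ^+ q) i j)
    = (fun p => (\sum_(0 <= q < p) (q`!%:R : R[i])^-1 * ('i%C * (v 0 i)%:C) ^+ q)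
        *+ (i == j)).
  apply/funext => p; rewrite summxE -sumrMnl; apply: eq_bigr => q _.
  by rewrite diag_mxX !mxE mulrnAr.
case: (i == j); last by rewrite mulr0n; apply: cvg_cst.
by rewrite mulr1n; exact: cvg_exp_imag.
Qed.

(** * The operators W_j in the tensor basis *)

Lemma number_factorE (R : rcfType) n d (k : 'I_n) :
  number_factor R d k =
  diag_mx (\row_s ((enum_val s : {ffun 'I_n -> 'I_d}) k)%:R).
Proof.
apply/matrixP => s t; rewrite !mxE.
case: (eqVneq s t) => [<-|neq].
  rewrite (bigD1 k) //= eqxx !mxE eqxx !mulr1n big1 ?mulr1 // => l lk.
  by rewrite (negbTE lk) mxE eqxx.
(* Distinct basis states differ in some factor [l]; both the number operator and the identity are
   diagonal there, so the product has a zero factor. *)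
have [l neql] : exists l, (enum_val s : {ffun 'I_n -> 'I_d}) l
                       != (enum_val t : {ffun 'I_n -> 'I_d}) l.
  apply/existsP; apply: contra_neqT neq; rewrite negb_exists => /forallP E.
  by apply/enum_val_inj/ffunP => l; apply/eqP; rewrite -[_ == _]negbK.
rewrite (bigD1 l) //= mulr0n.
by case: (l == k); rewrite !mxE (negbTE neql) mul0r.
Qed.

Lemma expmx_number_factor (R : realType) n d (k : 'I_n) (t : R) :
  expmx (('i%C * t%:C) *: number_factor R d k) =
  diag_mx (\row_s cexp ('i%C * t%:C) ^+ (enum_val s : {ffun 'I_n -> 'I_d}) k).
Proof.
pose v : 'rV[R]_(tdim n d) :=
  \row_s (t * ((enum_val s : {ffun 'I_n -> 'I_d}) k)%:R).
have -> : ('i%C * t%:C) *: number_factor R d k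
    = diag_mx (\row_s ('i%C * (v 0 s)%:C)).
  apply/matrixP => r s; rewrite number_factorE !mxE rmorphM rmorph_nat.
  by case: (r == s); rewrite ?mulr0n ?mulr0 // !mulr1n mulrA.
rewrite expmx_diag_imag; congr diag_mx; apply/rowP => s.
by rewrite !mxE cexp_imagMn.
Qed.

Lemma decouplerE (R : realType) u n N d (D : 'M['Z_u]_(n, N)) j :
  decoupler R d D j =
  diag_mx (\row_s \prod_(k < n)
     phase_mx R D k j ^+ (enum_val s : {ffun 'I_n -> 'I_d}) k).
Proof.
rewrite /decoupler; under eq_bigr do rewrite expmx_number_factor.
rewrite prod_diag_mx; congr diag_mx; apply/rowP => s; rewrite !mxE.
by apply: eq_bigr => k _; rewrite !mxE.
Qed.

Lemma phase_mx_unit (R : realType) u n N (D : 'M['Z_u]_(n, N)) k j :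
  phase_mx R D k j * Num.conj (phase_mx R D k j) = 1.
Proof. by rewrite mxE cexp_imag_unit. Qed.

(** Write m for the phase of the factor at hand. In factor k the nonzero entries of a have row x and
    column x+1, giving m^x conj(m)^(x+1) = conj(m). In every other factor the identity forces equal
    indices and the unimodular phases cancel. *)
Lemma decoupler_ann_factor (R : realType) u n N d (D : 'M['Z_u]_(n, N)) j k :
  decoupler R d D j *m ann_factor R d k *m (decoupler R d D j)^t* =
  Num.conj (phase_mx R D k j) *: ann_factor R d k.
Proof.
rewrite decouplerE tr_diag_mx map_diag_mx mul_diag_mx mul_mx_diag.
move cE: (Num.conj (phase_mx R D k j)) => c.
(* Spreading the scalar over the factors lets the two sides be compared factor by factor. *)
have -> : c = \prod_(l < n) (if l == k then c else 1).
  by rewrite -big_mkcond big_pred1_eq.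
apply/matrixP => s t; rewrite !mxE rmorph_prod -!big_split /=.
apply: eq_bigr => l _ /=; rewrite rmorphXn /=.
set x := (enum_val s : {ffun 'I_n -> 'I_d}) l.
set y := (enum_val t : {ffun 'I_n -> 'I_d}) l.
have unit q : phase_mx R D l j ^+ q * Num.conj (phase_mx R D l j) ^+ q = 1.
  by rewrite -exprMn phase_mx_unit expr1n.
case: (eqVneq l k) => [lk|_].
  rewrite [annihilation _ _ _ _]mxE.
  case: (x.+1 =P y :> nat) => [<-|_]; last by rewrite !(mulr0, mul0r).
  by rewrite exprS mulrAC mulrCA unit mulr1 -cE lk.
rewrite mul1r [1%:M _ _]mxE; case: (x =P y) => [->|_]; last by rewrite !(mulr0, mul0r).
by rewrite mulr1 unit.
Qed.

Lemma decoupler_unitary (R : realType) u n N d (D : 'M['Z_u]_(n, N)) j :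
  (decoupler R d D j)^t* *m decoupler R d D j = 1%:M.
Proof.
rewrite decouplerE tr_diag_mx map_diag_mx mulmx_diag.
apply/matrixP => s t; rewrite !mxE rmorph_prod -big_split /= big1 // => k _.
by rewrite rmorphXn -exprMn mulrC phase_mx_unit expr1n.
Qed.

(** * Roots of unity and the Gram matrix of M *)

Lemma cexp_2pi (R : realType) : cexp ('i%C * (2 * pi : R)%:C) = 1.
Proof. by rewrite cexp_imag [2 * pi]mulr_natl cos2pi sin2pi. Qed.

Definition unit_root (R : realType) (u : nat) : R[i] :=
  cexp ('i%C * (2 * pi / u%:R : R)%:C).

Lemma phase_mxE (R : realType) u n N (D : 'M['Z_u]_(n, N)) k j :
  phase_mx R D k j = unit_root R u ^+ D k j.
Proof. by rewrite mxE -cexp_imagMn mulrAC. Qed.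

(** The real part is cos(2 pi/u) = 1 - 2 sin(pi/u)^2, which is below 1 because 0 < pi/u < pi. *)
Lemma unit_root_neq1 (R : realType) u : (1 < u)%N -> unit_root R u != 1.
Proof.
move=> u1; rewrite /unit_root cexp_imag eq_complex /= negb_and; apply/orP; left.
have -> : 2 * pi / u%:R = (pi / u%:R : R) *+ 2 by rewrite -mulrA mulr_natl.
rewrite cos_mulr2n cos2sin2 mulrnBl addrAC [1 *+ 2]mulr2n addrK.
rewrite lt_eqF // ltrBlDr ltrDl mulrn_wgt0 // exprn_gt0 // sin_gt0_pi //.
have u0 : 0 < u%:R :> R by rewrite ltr0n (ltn_trans _ u1).
by rewrite divr_gt0 ?pi_gt0 //= ltr_pdivrMr // ltr_pMr ?pi_gt0 // ltr1n.
Qed.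

Lemma unit_rootXn (R : realType) u : (0 < u)%N -> unit_root R u ^+ u = 1.
Proof. by move=> u0; rewrite -cexp_imagMn divfK ?cexp_2pi // pnatr_eq0 -lt0n. Qed.

Lemma unit_rootXD (R : realType) u (x y : 'Z_u) : (1 < u)%N ->
  unit_root R u ^+ (x + y)%R = unit_root R u ^+ x * unit_root R u ^+ y.
Proof.
move=> u1; rewrite -exprD -[RHS](expr_mod _ (unit_rootXn R (ltnW u1))).
(* Addition in ['Z_u] reduces modulo [(Zp_trunc u).+2], which equals [u] since [1 < u]. *)
by congr (_ ^+ _); exact: (congr1 (modn (x + y)%N) (Zp_cast u1)).
Qed.

Lemma unit_rootXB (R : realType) u (x y : 'Z_u) : (1 < u)%N ->
  unit_root R u ^+ x * Num.conj (unit_root R u ^+ y) = unit_root R u ^+ (x - y)%R.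
Proof.
move=> u1; rewrite -{1}(subrK y x) (unit_rootXD R (x - y) y u1) -mulrA.
by rewrite -(cexp_imagMn _ y) cexp_imag_unit mulr1.
Qed.

(** Translation by 1 permutes ['Z_u], so the sum is unchanged when multiplied by the root, which
    differs from 1. *)
Lemma sum_unit_root (R : realType) u : (1 < u)%N ->
  \sum_(x : 'Z_u) unit_root R u ^+ x = 0.
Proof.
move=> u1; have /eqP : (\sum_(x : 'Z_u) unit_root R u ^+ x) * (unit_root R u - 1) = 0.
  rewrite mulrBr mulr1 [X in _ - X](reindex_inj (addIr 1)) mulr_suml -sumrB.
  by rewrite big1 // => x _; rewrite (unit_rootXD R x 1 u1) expr1 subrr.
by rewrite mulf_eq0 subr_eq0 (negbTE (unit_root_neq1 R u1)) orbF => /eqP.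
Qed.

Lemma phase_mx_gram (R : realType) u n N (D : 'M['Z_u]_(n, N)) :
  (1 < u)%N -> difference_scheme D ->
  phase_mx R D *m (phase_mx R D)^t* = N%:R%:M.
Proof.
move=> u1 hD; apply/matrixP => k l; rewrite mxE [RHS]mxE.
have -> : \sum_j phase_mx R D k j * (phase_mx R D)^t* j l
    = \sum_j unit_root R u ^+ (D k j - D l j)%R.
  apply: eq_bigr => j _.
  by rewrite [map_mx _ _ _ _]mxE [trmx _ _ _]mxE !phase_mxE unit_rootXB.
have [->|kl] := eqVneq k l.
  by under eq_bigr do rewrite subrr expr0; rewrite sumr_const card_ord.
(* Columns are grouped by the value of the row difference. By [hD] all groups have the size of the
   group of 0, which factors out of the sum over all roots. *)
rewrite (partition_big (fun j => D k j - D l j) predT) //.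
transitivity ((\sum_(x : 'Z_u) unit_root R u ^+ x)
    *+ #|[set j : 'I_N | D k j - D l j == 0]%SET|).
  rewrite -sumrMnl; apply: eq_bigr => x _.
  rewrite (hD _ _ kl 0 x) cardsE -sumr_const.
  by apply: eq_bigr => j /eqP->.
by rewrite sum_unit_root // mul0rn mulr0n.
Qed.

(** * Conjugated couplings and their sum over j *)

Lemma conj_decoupler_coupling (R : realType) u n N d (D : 'M['Z_u]_(n, N)) j k l :
  decoupler R d D j *m (ann_factor R d k *m (ann_factor R d l)^t*)
    *m (decoupler R d D j)^t*
  = (phase_mx R D l j * Num.conj (phase_mx R D k j))
      *: (ann_factor R d k *m (ann_factor R d l)^t*).
Proof.
set W := decoupler R d D j; set A := ann_factor R d k; set B := ann_factor R d l.
have tcM m1 m2 m3 (X : 'M[R[i]]_(m1, m2)) (Y : 'M[R[i]]_(m2, m3)) :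
    (X *m Y)^t* = Y^t* *m X^t* by rewrite trmx_mul map_mxM.
(* Unitarity allows W^dagger W to be inserted between the two operators; the outer adjoint then
   turns the scalar conj(m_lj) of the second one into m_lj. *)
have -> : W *m (A *m B^t*) *m W^t* = (W *m A *m W^t*) *m (W *m B *m W^t*)^t*.
  rewrite !tcM trmxCK !mulmxA; congr (_ *m _ *m _).
  by rewrite -[in RHS](mulmxA _ _ W) decoupler_unitary mulmx1.
rewrite !decoupler_ann_factor linearZ map_mxZ /= conjCK.
by rewrite -scalemxAl -scalemxAr scalerA mulrC.
Qed.

Theorem mainTheorem7 (R : realType) (u n N d : nat)
    (hu : (2 <= u)%N) (hn : (2 <= n)%N) (hN : (1 <= N)%N) (hd : (2 <= d)%N)
    (D : 'M['Z_u]_(n, N)) (hD : difference_scheme D) :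
  phase_mx R D *m (phase_mx R D)^t* = N%:R%:M /\
  forall c : 'M[R]_n, c^T = c -> (forall k : 'I_n, c k k = 0) ->
    \sum_(j < N) decoupler R d D j *m bilinear_coupling d c
                   *m (decoupler R d D j)^t* = 0.
Proof.
have gram := phase_mx_gram R hu hD; split=> // c _ c0.
under eq_bigr => j _.
  rewrite mulmx_sumr mulmx_suml.
  under eq_bigr => k _.
    rewrite mulmx_sumr mulmx_suml.
    under eq_bigr do rewrite -scalemxAr -scalemxAl conj_decoupler_coupling.
    over.
  over.
(* With the sum over [j] moved innermost, each pair (k, l) can be shown to contribute 0 on its own,
   since only the phases depend on [j]. *)
rewrite exchange_big big1 //= => k _; rewrite exchange_big big1 //= => l _.
rewrite -scaler_sumr -scaler_suml.
have [->|kl] := eqVneq k l; first by rewrite c0 scale0r.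
suff -> : \sum_j phase_mx R D l j * Num.conj (phase_mx R D k j) = 0.
  by rewrite scale0r scaler0.
(* The indices are swapped: the remaining phase sum is the entry (l, k) of the Gram matrix. *)
have /matrixP/(_ l k) := gram; rewrite mxE [RHS]mxE eq_sym (negbTE kl) mulr0n.
move=> E; rewrite -[RHS]E; apply: eq_bigr => j _.
by rewrite [map_mx _ _ _ _]mxE [trmx _ _ _]mxE.
Qed.
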